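(* Let $P_2=ENEN$, $P_3=NEEN$, $P_4=ENNE$, $P_5=NENE$, and let $$F_{2,3,4,5}(x_2,x_3,x_4,x_5,t)=1+\sum_{n\ge 1}t^n\sum_{L\in\mathcal{L}_n}x_2^{P_2\text{-mch}(L)}x_3^{P_3\text{-mch}(L)}x_4^{P_4\text{-mch}(L)}x_5^{P_5\text{-mch}(L)}.$$ Then $F_{2,3,4,5}=P/Q$, where \begin{align*} P={}&(-1+\sqrt{1-4t}+2t)x_3(-1+x_4)+x_4-\sqrt{1-4t}\,x_4-2tx_4\\ &+x_2\left(-(-1+\sqrt{1-4t})(-2+x_5)-2t(-1+x_5)\right)\\ &+2\sqrt{1-4t}\,x_5+2tx_5-2(-2+\sqrt{1-4t}+x_5) \end{align*} and \begin{align*} Q={}&2+(-1+\sqrt{1-4t}+2t)x_3x_4+(-1+\sqrt{1-4t})x_5\\ &+x_2\left(-1+\sqrt{1-4t}-(-1+\sqrt{1-4t}+2t)x_5\right). \end{align*}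
   Context: $\mathcal{L}_n$ is the set of lattice paths from $(0,0)$ to $(n,n)$ consisting of unit north steps $N$ and unit east steps $E$, equivalently words with $n$ letters $E$ and $n$ letters $N$. For $L\in\mathcal{L}_n$ and $A\subseteq\{1,\dots,n\}$, $ps_L(A)$ is the word obtained from $L$ by deleting, for every $i\in\{1,\dots,n\}\setminus A$, the $i$-th occurrence of $E$ and the $i$-th occurrence of $N$ (reading from left to right). For a pattern $P_k\in\mathcal{L}_2$, $P_k\text{-mch}(L)$ is the number of $j\in\{1,\dots,n-1\}$ with $ps_L(\{j,j+1\})=P_k$. Identities are between formal power series in $t$ with coefficients polynomial in $x_2,x_3,x_4,x_5$; $\sqrt{1-4t}$ denotes the formal power series square root with constant term $1$. *)

(* Defs.v *)
From HB Require Import structures.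
From mathcomp Require Import all_boot all_order all_algebra.
From mathcomp Require Import boolp.
From mathcomp Require Export mpoly.

Set Implicit Arguments.
Unset Strict Implicit.
Unset Printing Implicit Defensive.

Import GRing.Theory.
Local Open Scope ring_scope.

(** * Formal power series over a commutative unit ring *)

Record fps (R : Type) := FPS { fps_coef : nat -> R }.

HB.instance Definition _ (R : Type) := gen_eqMixin (fps R).
HB.instance Definition _ (R : Type) := gen_choiceMixin (fps R).

Notation "f ``_ n" := (fps_coef f n)
  (at level 3, n at level 2, left associativity, format "f ``_ n") : ring_scope.

Lemma fpsP (R : Type) (f g : fps R) : (forall n, f``_n = g``_n) <-> f = g.
Proof.
split=> [|-> //]; case: f g => [f] [g] /= fg.
by congr FPS; apply/funext.
Qed.

Section FpsRing.
Variable R : comUnitRingType.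
Implicit Types (f g h : fps R).

Definition fps_zero : fps R := FPS (fun=> 0).
Definition fps_one : fps R := FPS (fun n => (n == 0%N)%:R).
Definition fps_opp f : fps R := FPS (fun n => - f``_n).
Definition fps_add f g : fps R := FPS (fun n => f``_n + g``_n).
Definition fps_mul f g : fps R :=
  FPS (fun n => \sum_(i < n.+1) f``_i * g``_(n - i)).

Fact fps_addA : associative fps_add.
Proof. by move=> f g h; apply/fpsP => n /=; rewrite addrA. Qed.
Fact fps_addC : commutative fps_add.
Proof. by move=> f g; apply/fpsP => n /=; rewrite addrC. Qed.
Fact fps_add0 : left_id fps_zero fps_add.
Proof. by move=> f; apply/fpsP => n /=; rewrite add0r. Qed.
Fact fps_addN : left_inverse fps_zero fps_opp fps_add.
Proof. by move=> f; apply/fpsP => n /=; rewrite addNr. Qed.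

HB.instance Definition _ :=
  GRing.isZmodule.Build (fps R) fps_addA fps_addC fps_add0 fps_addN.

Fact fps_mulC : commutative fps_mul.
Proof.
move=> f g; apply/fpsP => n /=; rewrite (reindex_inj rev_ord_inj) /=.
by apply: eq_bigr => i _; rewrite subSS mulrC subKn // -ltnS.
Qed.

(* Low-order coefficients depend only on low-order coefficients, which reduces
   the ring laws to those of polynomials. *)
Let trunc n f : {poly R} := \poly_(i < n.+1) f``_i.

Let trunc_mul n f g k : (k <= n)%N ->
  (trunc n f * trunc n g)`_k = (fps_mul f g)``_k.
Proof.
move=> kn; rewrite coefM; apply: eq_bigr => i _.
by rewrite !coef_poly !ltnS (leq_trans (leq_subr _ _) kn) (leq_trans _ kn) // -ltnS.
Qed.

Let trunc_coef n f k : (k <= n)%N -> (trunc n f)`_k = f``_k.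
Proof. by move=> kn; rewrite coef_poly ltnS kn. Qed.

Fact fps_mulA : associative fps_mul.
Proof.
move=> f g h; apply/fpsP => n.
transitivity ((trunc n f * (trunc n g * trunc n h))`_n).
  rewrite coefM; apply: eq_bigr => i _.
  by rewrite trunc_coef -1?ltnS // trunc_mul // leq_subr.
rewrite mulrA coefM; apply: eq_bigr => i _.
by rewrite trunc_mul -1?ltnS // trunc_coef // leq_subr.
Qed.

Fact fps_mul1 : left_id fps_one fps_mul.
Proof.
move=> f; apply/fpsP => n /=; rewrite big_ord_recl /= mul1r subn0 big1 ?addr0 //.
by move=> i _; rewrite mul0r.
Qed.

Fact fps_mulDl : left_distributive fps_mul fps_add.
Proof.
move=> f g h; apply/fpsP => n /=; rewrite -big_split /=.
by apply: eq_bigr => i _; rewrite mulrDl.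
Qed.

Fact fps_one_neq0 : fps_one != fps_zero.
Proof.
apply/eqP => /(congr1 (fun f => f``_0)) /= /eqP.
by rewrite (negPf (oner_neq0 R)).
Qed.

HB.instance Definition _ :=
  GRing.Zmodule_isComNzRing.Build (fps R)
    fps_mulA fps_mulC fps_mul1 fps_mulDl fps_one_neq0.

Lemma fps_coef0 n : (0 : fps R)``_n = 0. Proof. by []. Qed.
Lemma fps_coef1 n : (1 : fps R)``_n = (n == 0%N)%:R. Proof. by []. Qed.
Lemma fps_coefN f n : (- f)``_n = - f``_n. Proof. by []. Qed.
Lemma fps_coefD f g n : (f + g)``_n = f``_n + g``_n. Proof. by []. Qed.
Lemma fps_coefM f g n : (f * g)``_n = \sum_(i < n.+1) f``_i * g``_(n - i).
Proof. by []. Qed.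

End FpsRing.

(* The sequence [u] with [u n = step [:: u 0; ...; u n.-1]]. *)
Section CourseOfValues.
Variables (T : Type) (step : seq T -> T).

Fixpoint cov_prefix n : seq T :=
  if n is n'.+1 then rcons (cov_prefix n') (step (cov_prefix n')) else [::].

Definition cov n : T := step (cov_prefix n).

Lemma cov_prefixE n : cov_prefix n = mkseq cov n.
Proof. by elim: n => //= n IHn; rewrite mkseqS -IHn. Qed.

Lemma covE n : cov n = step (mkseq cov n).
Proof. by rewrite /cov cov_prefixE. Qed.

End CourseOfValues.

(** A series is invertible iff its constant coefficient is; the coefficients
    of the inverse come from solving [f * g = 1] degree by degree. *)
Section FpsUnitRing.
Variable R : comUnitRingType.
Implicit Types (f g : fps R).

Definition fps_unit : pred (fps R) := fun f => f``_0 \is a GRing.unit.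

Definition fps_inv_step f (s : seq R) : R :=
  (f``_0)^-1 * ((size s == 0%N)%:R - \sum_(i < size s) s`_i * f``_(size s - i)).

Definition fps_inv f : fps R :=
  if fps_unit f then FPS (cov (fps_inv_step f)) else f.

Fact fps_mulVr : {in fps_unit, left_inverse 1 fps_inv *%R}.
Proof.
move=> f; rewrite unfold_in => uf; apply/fpsP => n.
have uf' : fps_unit f by [].
rewrite /fps_inv uf' fps_coefM big_ord_recr /= subnn.
rewrite (covE _ n) /fps_inv_step size_mkseq mulrC mulVKr //.
rewrite [X in X + _](eq_bigr (fun i : 'I_n =>
  (mkseq (cov (fps_inv_step f)) n)`_i * f``_(n - i))).
  by rewrite addrC subrK.
by move=> i _; rewrite nth_mkseq.
Qed.

Fact fps_unitPl f g : g * f = 1 -> fps_unit f.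
Proof.
move=> /fpsP/(_ 0%N); rewrite fps_coefM big_ord1 fps_coef1 /= => gf.
by apply/unitrP; exists g``_0; rewrite [in X in _ /\ X]mulrC.
Qed.

Fact fps_inv_out : {in [predC fps_unit], fps_inv =1 id}.
Proof. by move=> f nuf; rewrite /fps_inv ifN. Qed.

HB.instance Definition _ :=
  GRing.ComNzRing_hasMulInverse.Build (fps R) fps_mulVr fps_unitPl fps_inv_out.

Lemma fps_unitE f : (f \is a GRing.unit) = (f``_0 \is a GRing.unit).
Proof. by []. Qed.

End FpsUnitRing.

Section FpsOps.
Variable R : comUnitRingType.
Implicit Types (c : R) (f g : fps R).

Definition fpsC c : fps R := FPS (fun n => if n is 0 then c else 0).

Definition fpsX : fps R := FPS (fun n => (n == 1%N)%:R).

(* The square root with constant coefficient 1 of a series with constant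
   coefficient 1, when 2 is invertible in R; see [fps_sqrtK] and
   [fps_sqrt_uniq].  The coefficients come from solving [s * s = f] degree by
   degree. *)
Definition fps_sqrt_step f (s : seq R) : R :=
  if size s is n.+1 then
    (f``_n.+1 - \sum_(i < n) s`_i.+1 * s`_(n - i)) / 2%:R
  else 1.

Definition fps_sqrt f : fps R := FPS (cov (fps_sqrt_step f)).

Lemma fps_sqrt0 f : (fps_sqrt f)``_0 = 1.
Proof. by []. Qed.

Lemma fps_sqrtK f : (2%:R : R) \is a GRing.unit -> f``_0 = 1 ->
  fps_sqrt f ^+ 2 = f.
Proof.
move=> u2 f0; apply/fpsP => -[|n]; rewrite expr2 fps_coefM.
  by rewrite big_ord1 !fps_sqrt0 mulr1.
rewrite big_ord_recl big_ord_recr /= subnn.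
have -> : cov (fps_sqrt_step f) 0 = 1 by [].
rewrite mulr1 mul1r -/(bump 0 n) /= subn0 addrCA -mulr2n.
rewrite (covE _ n.+1) /fps_sqrt_step size_mkseq -/(fps_sqrt_step f).
rewrite -[X in _ + X]mulr_natr divrK //.
set A := (X in X + _); set B := (X in _ - X).
suff -> : A = B by rewrite addrC subrK.
apply: eq_bigr => i _; rewrite /bump leq0n add1n subSS.
have ni : (n - i < n.+1)%N by rewrite ltnS leq_subr.
have i1 : (i.+1 < n.+1)%N by rewrite ltnS.
by rewrite (nth_mkseq _ _ ni) (nth_mkseq _ _ i1).
Qed.

Lemma fps_sqrt_uniq f g : (2%:R : R) \is a GRing.unit ->
  g``_0 = 1 -> g ^+ 2 = f -> g = fps_sqrt f.
Proof.
move=> u2 g0 gf.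
have f0 : f``_0 = 1 by rewrite -gf expr2 fps_coefM big_ord1 g0 mulr1.
have u : g + fps_sqrt f \is a GRing.unit.
  by rewrite fps_unitE fps_coefD g0 fps_sqrt0.
apply/eqP; rewrite -subr_eq0; apply/eqP/(mulIr u).
by rewrite mul0r -subr_sqr gf fps_sqrtK // subrr.
Qed.

End FpsOps.

(** * Lattice paths *)

Inductive step := E | N.

Definition step_to_bool (s : step) : bool := if s is E then true else false.
Definition bool_to_step (b : bool) : step := if b then E else N.
Fact step_to_boolK : cancel step_to_bool bool_to_step.
Proof. by case. Qed.
HB.instance Definition _ := Finite.copy step (can_type step_to_boolK).

Definition lattice_paths (n : nat) : {set (n + n).-tuple step} :=
  [set w : (n + n).-tuple step | (count_mem E w == n) && (count_mem N w == n)].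

(* The letter at position [p] (counted from 0) of [w] is the
   [occurrence w p]-th letter of its kind, counted from 1. *)
Definition occurrence (w : seq step) (p : nat) : nat :=
  count_mem (nth E w p) (take p.+1 w).

(* [A] is a set of positive integers; the i-th E and the i-th N of [w] are
   deleted for every i outside [A]. *)
Definition ps (w : seq step) (A : pred nat) : seq step :=
  mask [seq A (occurrence w p) | p <- iota 0 (size w)] w.

(* Pattern matches in a path [w] of length [2 * n]; [j] ranges over 1..n-1. *)
Definition mch (P : seq step) (n : nat) (w : seq step) : nat :=
  count (fun j => ps w (pred2 j j.+1) == P) (iota 1 n.-1).

Definition P2 := [:: E; N; E; N].
Definition P3 := [:: N; E; E; N].
Definition P4 := [:: E; N; N; E].
Definition P5 := [:: N; E; N; E].

(** * The generating function *)

(* X2, ..., X5 are the indeterminates x_2, ..., x_5.  The scalars are rational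
   since series inversion and square roots require 2 to be invertible. *)
Definition X2 : {mpoly rat[4]} := 'X_(@Ordinal 4 0 isT).
Definition X3 : {mpoly rat[4]} := 'X_(@Ordinal 4 1 isT).
Definition X4 : {mpoly rat[4]} := 'X_(@Ordinal 4 2 isT).
Definition X5 : {mpoly rat[4]} := 'X_(@Ordinal 4 3 isT).

Definition F2345 : fps {mpoly rat[4]} :=
  FPS (fun n => if n is 0 then 1 else
    \sum_(L in lattice_paths n)
      X2 ^+ mch P2 n L * X3 ^+ mch P3 n L * X4 ^+ mch P4 n L * X5 ^+ mch P5 n L).

Lemma sqrt_1_4tK :
  let t := fpsX {mpoly rat[4]} in
  fps_sqrt (1 - 4 * t : fps {mpoly rat[4]}) ^+ 2 = 1 - 4 * t.
Proof.
move=> t; apply: fps_sqrtK.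
  have -> : (2%:R : {mpoly rat[4]}) = (2%:R : rat)%:MP.
    by rewrite mpolyCMn mpolyC1.
  by apply/unitrP; exists ((2%:R : rat)^-1)%:MP; rewrite -!mpolyCM; split.
rewrite fps_coefD fps_coefN fps_coef1 fps_coefM big_ord1 /=.
by rewrite mulr0 subr0.
Qed.

(* Main.v *)
(** A match of one of the four patterns at j says exactly that the path visits
    the diagonal at (j, j), and the pattern records the steps by which it
    enters and leaves.  So the weight of a path is a product over its interior
    diagonal visits.  Let A_h be the weighted series of the paths that end at
    distance h > 0 on a fixed side of the diagonal, and B the series of
    diagonal paths weighted by their departure to that side.  Removing the last
    step gives A_h = A_{h-1} + t A_{h+1} with A_0 replaced by B, hence
    A_h = B C^h where C = 1 + t C^2, that is t C = (1 - sqrt(1-4t))/2.  The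
    series t A_1 for the two sides then satisfy a 2 x 2 linear system, and
    F = 1 + (sum of the two). *)

Require Import Defs.
From mathcomp Require Import all_boot all_order all_algebra.
From mathcomp Require Import ring zify.
Import GRing.Theory.

Set Implicit Arguments.
Unset Strict Implicit.
Unset Printing Implicit Defensive.

(** * Steps and their counts *)

Definition flip (s : step) : step := if s is E then N else E.

Lemma eq_flip (x y : step) : (x == flip y) = (x != y).
Proof. by case: x; case: y. Qed.

Lemma eq_flip_refl (d : step) : (d == flip d) = false.
Proof. by case: d. Qed.

Lemma count_flip (x : step) (w : seq step) :
  (count_mem x w + count_mem (flip x) w)%N = size w.
Proof. by elim: w => //= y w <-; case: x y => [] [] /=; lia. Qed.

Lemma countEN (w : seq step) : (count_mem E w + count_mem N w)%N = size w.
Proof. exact: count_flip E w. Qed.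

Lemma count_mem_rcons (x y : step) (w : seq step) :
  count_mem x (rcons w y) = (count_mem x w + (x == y))%N.
Proof. by rewrite -cats1 count_cat /= addn0 eq_sym. Qed.

(** * Reduced words and diagonal visits *)

Section Ps.
Variable A : pred nat.

(** Occurrence numbers depend only on the prefix read so far, so [ps] can be computed letter by
    letter. *)
Lemma ps_rcons (w : seq step) (x : step) :
  ps (rcons w x) A = ps w A ++ nseq (A (count_mem x w).+1) x.
Proof.
rewrite /ps size_rcons -addn1 iotaD map_cat -cats1 mask_cat ?size_map ?size_iota //=.
congr (mask _ _ ++ _).
  apply/eq_in_map => p; rewrite mem_iota add0n /= => pw.
  rewrite /occurrence nth_cat pw take_cat ltn_neqAle pw andbT.
  case: eqP => // e.
  by rewrite e subnn take0 cats0 take_size.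
rewrite /occurrence add0n nth_cat ltnn subnn /= take_oversize ?size_cat ?addn1 //.
by rewrite count_cat /= eqxx addn1; case: (A _).
Qed.

Lemma count_ps (x : step) (w : seq step) :
  count_mem x (ps w A) = count A (iota 1 (count_mem x w)).
Proof.
elim/last_ind: w => // w y IH.
rewrite ps_rcons count_cat IH count_nseq count_mem_rcons iotaD count_cat.
by rewrite /= eq_sym add1n; case: (x =P y) => [->|_] /=; rewrite ?mul1n ?addn0.
Qed.

Lemma prefix_ps (u v : seq step) : prefix (ps u A) (ps (u ++ v) A).
Proof.
elim/last_ind: v => [|v y IH]; first by rewrite cats0 prefix_refl.
by rewrite -rcons_cat ps_rcons (prefix_trans IH) // prefix_prefix.
Qed.

End Ps.

Lemma count_pred2_iota (j k : nat) : (0 < j)%N ->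
  count (pred2 j j.+1) (iota 1 k) = ((j <= k) + (j < k))%N.
Proof.
move=> j0; elim: k => [|k IH]; first by case: j j0.
by rewrite -[k.+1]addn1 iotaD count_cat IH /=; lia.
Qed.

(** At a visit to (j, j), the entering step is the j-th of its kind and the leaving step the
    (j+1)-th, so both are kept and form the middle of the reduced word. *)
Lemma ps_pattern (w : seq step) (n j : nat) (x y : step) :
    size w = (n + n)%N -> count_mem E w = n -> (0 < j < n)%N ->
  (ps w (pred2 j j.+1) == [:: flip x; x; y; flip y]) =
  [&& count_mem E (take (j + j) w) == j,
      nth E w (j + j).-1 == x & nth E w (j + j) == y].
Proof.
move=> sw cE /andP[j0 jn]; set A := pred2 j j.+1.
have cN : count_mem N w = n by have := countEN w; rewrite sw; lia.
have cw z : count_mem z (ps w A) = 2.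
  by rewrite count_ps count_pred2_iota //; case: z; rewrite ?cE ?cN; lia.
have su : size (take (j + j) w) = (j + j)%N by rewrite size_take sw; case: ltnP; lia.
have := countEN (take (j + j) w); rewrite su => cu.
case: (count_mem E _ =P j) => [bal|unbal] /=; last first.
  (* Off the diagonal, the first 2j steps contain both kept occurrences of one letter [z] and none
     of the other, so the reduced word starts with [z z], unlike the pattern. *)
  apply/eqP => eqw.
  have : exists z, count_mem z (ps (take (j + j) w) A) = 2 /\
                   count_mem (flip z) (ps (take (j + j) w) A) = 0.
    have [] : count_mem E (take (j + j) w) < j \/
              j < count_mem E (take (j + j) w) by lia.
      by exists N; rewrite !count_ps !count_pred2_iota // [flip _]/=; lia.
    by exists E; rewrite !count_ps !count_pred2_iota // [flip _]/=; lia.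
  case=> z [z2 z0]; have := prefix_ps A (take (j + j) w) (drop (j + j) w).
  rewrite cat_take_drop eqw => /prefixP [s].
  case: (ps _ A) z2 z0 => [|a [|b s']] //=; rewrite ?addn0.
    by case: (_ == _).
  move=> z2 z0 [? ? _]; subst a b.
  by case: (x) z2 z0; case: (z).
have [u' [x' def_u]] : exists u' x', take (j + j) w = rcons u' x'.
  case/lastP: (take _ _) su => [|u' x' _]; last by exists u', x'.
  by rewrite /=; lia.
have def_w : w = rcons (rcons u' x') (nth E w (j + j)) ++ drop (j + j).+1 w.
  by rewrite -def_u cat_rcons -drop_nth ?cat_take_drop // sw; lia.
have su' : size u' = (j + j).-1 by move: su; rewrite def_u size_rcons => <-.
have nx : nth E w (j + j).-1 = x'.
  have -> : nth E w (j + j).-1 = nth E (take (j + j) w) (j + j).-1.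
    by rewrite nth_take //; lia.
  by rewrite def_u nth_rcons su' ltnn eqxx.
rewrite nx; set y' := nth E w (j + j) in def_w *.
have cux z : count_mem z (rcons u' x') = j by rewrite -def_u; case: z => //; lia.
have cux' z : (count_mem z u' + (z == x'))%N = j by rewrite -count_mem_rcons.
have [s def_s] : exists s, ps w A = ps u' A ++ [:: x'; y'] ++ s.
  have /prefixP[s] := prefix_ps A (rcons (rcons u' x') y') (drop (j + j).+1 w).
  rewrite -def_w !ps_rcons cux.
  have := cux' x'; rewrite eqxx addn1 => ->.
  by rewrite /= !eqxx orbT /= -!catA /= => ->; exists s.
have c0 : count_mem x' (ps u' A) = 0.
  by rewrite count_ps count_pred2_iota //; have := cux' x'; rewrite eqxx; lia.
have c1 : count_mem (flip x') (ps u' A) = 1.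
  rewrite count_ps count_pred2_iota //; have := cux' (flip x').
  by rewrite eq_sym eq_flip eqxx /=; lia.
have s1 : size (ps u' A) = 1 by rewrite -(count_flip x') c0 c1.
(* The reduced word is [flip x'], [x'], [y'], [s] with two letters of each kind, which forces [s] to
   be the single letter [flip y']. *)
move: (cw E) (cw N); rewrite def_s.
move: (ps u' A) s1 c0 y' {def_u def_w def_s nx cux cux' c1} => [|a []] //= _ c0 y'.
case: s => [|b [|b' s]] /=.
- by case: a x' y' c0 => [] [] [].
- by case: a x' y' b x y c0 => [] [] [] [] [] [].
- by case: a x' y' b b' c0 => [] [] [] [] [] /=; lia.
Qed.

(** * Balanced words and sums over words *)

Definition balanced (w : seq step) : bool := count_mem E w == count_mem N w.

Lemma balancedE (d : step) (w : seq step) :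
  balanced w = (size w == count_mem d w + count_mem d w).
Proof.
by rewrite /balanced -countEN; case: d; rewrite ?eqn_add2l ?eqn_add2r // eq_sym.
Qed.

Lemma odd_unbalanced (w : seq step) : odd (size w) -> balanced w = false.
Proof. by rewrite (balancedE E); case: eqP => // ->; rewrite addnn odd_double. Qed.

Fixpoint words (m : nat) : seq (seq step) :=
  if m is m'.+1 then [seq rcons w x | w <- words m', x <- [:: E; N]] else [:: [::]].

Lemma mem_words (m : nat) (w : seq step) : (w \in words m) = (size w == m).
Proof.
elim: m w => [|m IH] w; first by case: w.
case/lastP: w => [|w x]; first by apply/allpairsP => -[[[|? ?] ?] []].
rewrite size_rcons eqSS -IH; apply/allpairsP/idP => [[[u y] /= [uw _]]|ww].
  by move=> /rcons_inj [-> _].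
by exists (w, x); split=> //=; case: x.
Qed.

Lemma words_uniq (m : nat) : uniq (words m).
Proof.
elim: m => // m IH; apply: (allpairs_uniq IH) => // -[u x] [v y] _ _ /=.
by move=> /rcons_inj [-> ->].
Qed.

Local Open Scope ring_scope.

Lemma sum_words_rcons (V : nmodType) (d : step) (m : nat)
    (Q : pred (seq step)) (f : seq step -> V) :
  \sum_(w <- words m.+1 | Q w) f w =
  \sum_(w <- words m | Q (rcons w d)) f (rcons w d) +
  \sum_(w <- words m | Q (rcons w (flip d))) f (rcons w (flip d)).
Proof.
rewrite big_mkcond big_allpairs_dep /= [X in _ = X + _]big_mkcond.
rewrite [X in _ = _ + X]big_mkcond -big_split; apply: eq_bigr => w _.
by rewrite !big_cons big_nil addr0; case: d => //; rewrite addrC.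
Qed.

Lemma sum_lattice_paths (V : nmodType) (n : nat) (f : seq step -> V) :
  \sum_(L in lattice_paths n) f L =
  \sum_(w <- words (n + n) | count_mem E w == n) f w.
Proof.
have -> : \sum_(L in lattice_paths n) f L =
    \sum_(L : (n + n).-tuple step | count_mem E L == n) f L.
  apply: eq_bigl => L; rewrite inE; case: eqP => //= cE.
  by have := countEN L; rewrite size_tuple cE => /addnI ->; rewrite eqxx.
rewrite -(big_map val (fun w => count_mem E w == n) f); apply: perm_big.
apply: uniq_perm; rewrite ?words_uniq ?map_inj_uniq ?index_enum_uniq //.
  exact: val_inj.
move=> w; rewrite mem_words; apply/mapP/eqP => [[L _ ->]|sw].
  exact: size_tuple.
by exists (tcast sw (in_tuple w)); rewrite ?mem_index_enum //= val_tcast.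
Qed.

(** Paths meet the diagonal only after an even number of steps; this passes from prefix lengths to
    diagonal points. *)
Lemma prod_doubled (R : comNzRingType) (f : nat -> R) (m : nat) :
    (forall p, odd p -> (p < m + m)%N -> f p = 1) ->
  \prod_(1 <= p < m + m) f p = \prod_(1 <= j < m) f (j + j)%N.
Proof.
elim: m => [|m IH] f1; first by rewrite !big_geq.
have {}IH : \prod_(1 <= p < m + m) f p = \prod_(1 <= j < m) f (j + j)%N.
  by apply: IH => p op pm; apply: f1 => //; lia.
rewrite addSn addnS; case: m => [|m] in f1 IH *.
  by rewrite big_nat1 f1 ?big_geq.
rewrite (big_nat_recr (m.+1 + m.+1).+1) // (big_nat_recr (m.+1 + m.+1)) //=.
rewrite (big_nat_recr m.+1) //= IH [f (_ + _).+1]f1 ?mulr1 //=; last by lia.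
by rewrite addnS addnn /= odd_double.
Qed.

(** * Weights of paths and last-step recursions *)

Section Weight.
Variables (R : comUnitRingType) (q : step -> step -> R).

(* A path gets a factor [q x y] for each interior visit to the diagonal
   that it enters by the step [x] and leaves by the step [y]. *)
Definition wt (w : seq step) : R :=
  \prod_(1 <= p < size w | balanced (take p w)) q (nth E w p.-1) (nth E w p).

Lemma wt1 (x : step) : wt [:: x] = 1.
Proof. by rewrite /wt big_geq. Qed.

(** A visit is charged only when the path leaves it, so appending [y] affects only the visit at the
    old endpoint. *)
Lemma wt_rcons (w : seq step) (x y : step) :
  wt (rcons (rcons w x) y) =
  wt (rcons w x) * (if balanced (rcons w x) then q x y else 1).
Proof.
rewrite /wt size_rcons size_rcons big_mkcond big_nat_recr //=; congr (_ * _).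
  rewrite [RHS]big_mkcond; apply: eq_big_nat => p /andP[p0 pw].
  rewrite -cats1 takel_cat ?size_rcons 1?ltnW // !nth_cat !size_rcons pw.
  by rewrite (leq_ltn_trans (leq_pred p) pw).
rewrite -[rcons (rcons w x) y]cats1 take_cat !nth_cat size_rcons ltnn subnn /= cats0.
by rewrite ltnSn nth_rcons ltnn eqxx.
Qed.

Lemma wt_rcons_unbalanced (w : seq step) (x : step) :
  w != [::] -> ~~ balanced w -> wt (rcons w x) = wt w.
Proof. by case/lastP: w => // w y _ /negPf nb; rewrite wt_rcons nb mulr1. Qed.

(** By [ps_pattern], each interior visit gives exactly one of the four patterns, indexed by its two
    middle letters, and any other j gives none. *)
Lemma prod_mch (n : nat) (w : seq step) :
    size w = (n + n)%N -> count_mem E w = n ->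
  q N E ^+ mch P2 n w * q E E ^+ mch P3 n w *
    q N N ^+ mch P4 n w * q E N ^+ mch P5 n w = wt w.
Proof.
move=> sw cE; have exp_count (x : R) (a : pred nat) s :
    x ^+ count a s = \prod_(i <- s) (if a i then x else 1).
  by rewrite -big_mkcond big_const_seq iter_mulr_1.
rewrite /wt big_mkcond sw prod_doubled => [|p op pn]; last first.
  by rewrite odd_unbalanced // size_takel // sw ltnW.
rewrite /mch !exp_count -!big_split /= /index_iota subn1.
apply: eq_big_seq => j; rewrite mem_iota => jn.
have j0n : (0 < j < n)%N by lia.
rewrite (ps_pattern N E sw cE j0n) (ps_pattern E E sw cE j0n).
rewrite (ps_pattern N N sw cE j0n) (ps_pattern E N sw cE j0n).
rewrite (balancedE E) size_takel; last by rewrite sw; lia.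
set k := count_mem E _; have -> : (j + j == k + k)%N = (k == j) by lia.
case: (_ == j); rewrite /= ?mulr1 //.
by case: (nth _ _ _); case: (nth _ _ _); rewrite /= ?mulr1 ?mul1r.
Qed.

(* Paths with [j + h] steps [d] and [j] steps [flip d]: they end at distance
   [h] from the diagonal, on the side of [d]. *)
Definition path_sum (d : step) (h j : nat) : R :=
  \sum_(w <- words (j + j + h) | count_mem d w == (j + h)%N) wt w.

(** The appended [d] turns the endpoint into an interior visit when j > 0, so its factor is
    included. *)
Definition departure_sum (d : step) (j : nat) : R :=
  \sum_(w <- words (j + j) | count_mem d w == j) wt (rcons w d).

Lemma sum_wt_rcons (d x : step) (m k : nat) : (0 < m)%N -> (m != k + k)%N ->
  \sum_(w <- words m | count_mem d w == k) wt (rcons w x) =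
  \sum_(w <- words m | count_mem d w == k) wt w.
Proof.
move=> m0 mk; rewrite big_seq_cond [RHS]big_seq_cond.
apply: eq_bigr => w; rewrite mem_words => /andP[/eqP sw /eqP cw].
rewrite wt_rcons_unbalanced //; first by rewrite -size_eq0 sw -lt0n.
by rewrite (balancedE d) sw cw.
Qed.

Lemma path_sum_last (d : step) (h j : nat) :
  \sum_(w <- words (j + j + h) | count_mem d (rcons w (flip d)) == (j + h.+1)%N)
     wt (rcons w (flip d)) =
  if j is j'.+1 then path_sum d h.+2 j' else 0.
Proof.
under eq_bigl => w do rewrite count_mem_rcons eq_flip_refl addn0.
case: j => [|j].
  (* For j = 0 a word of length h would need h+1 letters [d]. *)
  rewrite big_seq_cond big1 // => w; rewrite mem_words => /andP[/eqP sw /eqP cw].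
  by have := count_size (pred1 d) w; rewrite sw cw; lia.
rewrite sum_wt_rcons; try lia.
by rewrite /path_sum !addSn !addnS.
Qed.

Lemma path_sum_step (d : step) (h j : nat) :
  path_sum d h.+2 j =
  path_sum d h.+1 j + (if j is j'.+1 then path_sum d h.+3 j' else 0).
Proof.
rewrite /path_sum [(j + j + h.+2)%N]addnS (sum_words_rcons d) path_sum_last.
congr (_ + _); under eq_bigl => w do rewrite count_mem_rcons eqxx addn1 addnS eqSS.
by apply: sum_wt_rcons; lia.
Qed.

(** Unlike at greater heights, a last step [d] here leaves the diagonal and charges a factor. *)
Lemma path_sum_step1 (d : step) (j : nat) :
  path_sum d 1 j =
  departure_sum d j + (if j is j'.+1 then path_sum d 2 j' else 0).
Proof.
rewrite -path_sum_last /path_sum addnS (sum_words_rcons d); congr (_ + _).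
by rewrite addn0; apply: eq_bigl => w; rewrite count_mem_rcons eqxx !addn1 eqSS.
Qed.

Lemma path_sum1_flip (d : step) (j : nat) :
  path_sum (flip d) 1 j = \sum_(w <- words (j + j + 1) | count_mem d w == j) wt w.
Proof.
rewrite /path_sum big_seq_cond [RHS]big_seq_cond; apply: eq_bigl => w.
rewrite mem_words; case: eqP => // sw; congr (_ && _).
by have := count_flip d w; rewrite sw; lia.
Qed.

Lemma departure_sum0 (d : step) : departure_sum d 0 = 1.
Proof. by rewrite /departure_sum /= big_cons big_nil /= wt1 addr0. Qed.

(** A last step [d] arrives from height 1 on the side of [flip d]. The free [f] serves both the
    departure factor and the plain sum. *)
Lemma balanced_sumS (d : step) (j : nat) (f : step -> R) :
  \sum_(w <- words (j.+1 + j.+1) | count_mem d w == j.+1) wt w * f (last d w) =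
  f d * path_sum (flip d) 1 j + f (flip d) * path_sum d 1 j.
Proof.
rewrite addnS (sum_words_rcons d) path_sum1_flip; congr (_ + _).
  under eq_bigl => w do rewrite count_mem_rcons eqxx addn1 eqSS.
  under eq_bigr => w _ do rewrite last_rcons mulrC.
  by rewrite -big_distrr sum_wt_rcons; [rewrite addSn addn1 | lia | lia].
under eq_bigl => w do rewrite count_mem_rcons eq_flip_refl addn0.
under eq_bigr => w _ do rewrite last_rcons mulrC.
rewrite -big_distrr sum_wt_rcons; [|lia|lia].
by rewrite /path_sum !addn1 addSn.
Qed.

Lemma departure_sumS (d : step) (j : nat) :
  departure_sum d j.+1 =
  q d d * path_sum (flip d) 1 j + q (flip d) d * path_sum d 1 j.
Proof.
rewrite -(balanced_sumS d j (fun x => q x d)) /departure_sum.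
rewrite big_seq_cond [RHS]big_seq_cond; apply: eq_bigr => w.
rewrite mem_words => /andP[/eqP sw /eqP cw].
have: balanced w by rewrite (balancedE d) sw cw.
case/lastP: w sw {cw} => // w x _ bw.
by rewrite wt_rcons bw last_rcons.
Qed.

Lemma balanced_wt_sumS (j : nat) :
  \sum_(w <- words (j.+1 + j.+1) | count_mem E w == j.+1) wt w =
  path_sum N 1 j + path_sum E 1 j.
Proof.
have := balanced_sumS E j (fun=> 1); rewrite !mul1r => <-.
by under [RHS]eq_bigr => w _ do rewrite mulr1.
Qed.

(** * Generating functions by height *)

Let t := fpsX R.

Lemma fpsX_coefM (f : fps R) (n : nat) :
  (fpsX R * f)``_n = if n is m.+1 then f``_m else 0.
Proof.
rewrite fps_coefM; case: n => [|n]; first by rewrite big_ord1 mul0r.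
rewrite big_ord_recl big_ord_recl big1 => [|i _]; last by rewrite mul0r.
by rewrite /= mul0r mul1r add0r addr0 /bump /= addn0 subSS subn0.
Qed.

Lemma fpsX_inj : injective (fun f : fps R => fpsX R * f).
Proof.
move=> f g fg; apply/fpsP => n; have /fpsP/(_ n.+1) := fg.
by rewrite !fpsX_coefM.
Qed.

(** Induction on the degree, then on the height: the factor [t] lowers the degree of the term at the
    greater height. *)
Lemma fps_rec0 (D : nat -> fps R) :
    D 0%N = 0 -> (forall h, D h.+1 = D h + t * D h.+2) ->
  forall h, D h = 0.
Proof.
move=> D0 DS; suff D00 n h : (D h)``_n = 0 by move=> h; apply/fpsP => n.
elim: n h => [|n IHn]; elim=> [|h IHh]; rewrite ?D0 //.
  by rewrite DS fps_coefD IHh fpsX_coefM addr0.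
by rewrite DS fps_coefD IHh fpsX_coefM IHn addr0.
Qed.

(** Restoring the uncharged step back to the diagonal, this counts nonempty balanced paths arriving
    from the side of [d]. *)
Definition excursion_fps (d : step) : fps R := t * FPS (path_sum d 1).

Lemma departure_fps (d : step) :
  FPS (departure_sum d) = 1 + fpsC (q d d) * excursion_fps (flip d)
    + fpsC (q (flip d) d) * excursion_fps d.
Proof.
have CM c (f : fps R) n : (fpsC c * f)``_n = c * f``_n.
  rewrite fps_coefM big_ord_recl subn0 big1 ?addr0 // => i _.
  by rewrite mul0r.
apply/fpsP => -[|j]; rewrite 2!fps_coefD !CM !fpsX_coefM /=.
  by rewrite departure_sum0 !mulr0 !addr0.
by rewrite departure_sumS add0r.
Qed.

(* Kernel method: [C ^+ h] solves the height recursion, and a formal power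
   series solution is determined by its value at height 0. *)
Lemma path_sum_fps (C : fps R) (d : step) (h : nat) : C = 1 + t * C ^+ 2 ->
  FPS (path_sum d h.+1) = FPS (departure_sum d) * C ^+ h.+1.
Proof.
(* Putting the departure series at height 0 makes one recursion valid at all heights. *)
move=> eC; pose A i := if i is i'.+1 then FPS (path_sum d i'.+1)
                       else FPS (departure_sum d).
apply/eqP; rewrite -subr_eq0; apply/eqP.
apply: (@fps_rec0 (fun i => A i - A 0%N * C ^+ i) _ _ h.+1) => [|i].
  by rewrite expr0 mulr1 subrr.
have -> : A i.+1 = A i + t * A i.+2.
  apply/fpsP => j; rewrite fps_coefD fpsX_coefM.
  by case: i => [|i] /=; rewrite ?path_sum_step1 ?path_sum_step //; case: j.
rewrite (exprS C i) {1}eC !exprS expr0; ring.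
Qed.

End Weight.

(** * The Catalan series *)

Section Catalan.
Variable R : comUnitRingType.
Let t := fpsX R.

Lemma fps_natr0 (n : nat) : (n%:R : fps R)``_0 = n%:R.
Proof. by elim: n => // n IH; rewrite !mulrS fps_coefD IH. Qed.

Lemma catalan_fps_sqrt : (2%:R : R) \is a GRing.unit -> exists C : fps R,
  fps_sqrt (1 - 4 * t) = 1 - 2 * (t * C) /\ C = 1 + t * C ^+ 2.
Proof.
move=> unit2; set r := fps_sqrt _.
have r2 : r ^+ 2 = 1 - 4 * t.
  apply: fps_sqrtK => //; rewrite fps_coefD fps_coefN [4 * t]mulrC fpsX_coefM.
  by rewrite subr0.
pose C : fps R := FPS (fun n => - r``_(n.+1) / 2).
have rC : r = 1 - 2 * (t * C).
  apply/fpsP => n; rewrite -[2]/(1 + 1) mulrDl mul1r -mulrDr.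
  rewrite fps_coefD fps_coefN fpsX_coefM.
  case: n => [|n]; first by rewrite fps_sqrt0 subr0.
  have CC : C``_n + C``_n = - r``_(n.+1).
    by rewrite -mulr2n -[_ *+ 2]mulr_natr /C /= divrK.
  by rewrite fps_coefD CC opprK add0r.
exists C; split=> //; apply: fpsX_inj.
have u4 : (4 : fps R) \is a GRing.unit.
  by rewrite fps_unitE fps_natr0 -[4%N]/(2 * 2)%N natrM unitrM unit2.
apply: (mulrI u4).
(* Expanding the square gives the Catalan equation multiplied by 4t. *)
have : (1 - 2 * (t * C)) ^+ 2 = 1 - 4 * t by rewrite -rC.
move=> e; rewrite -/t; apply/eqP; rewrite -subr_eq0; apply/eqP.
transitivity (1 - 4 * t - (1 - 2 * (t * C)) ^+ 2); first by ring.
by rewrite e subrr.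
Qed.

End Catalan.

(** * The linear system and the closed form *)

Lemma two_state_system (S : comNzRingType) (c x2 x3 x4 x5 zE zN : S) :
    zE = c * (1 + x3 * zN + x2 * zE) -> zN = c * (1 + x4 * zE + x5 * zN) ->
  let t := c - c ^+ 2 in let r := 1 - 2 * c in
  let P := (-1 + r + 2 * t) * x3 * (-1 + x4) + x4 - r * x4 - 2 * t * x4
    + x2 * (- (-1 + r) * (-2 + x5) - 2 * t * (-1 + x5))
    + 2 * r * x5 + 2 * t * x5 - 2 * (-2 + r + x5) in
  let Q := 2 + (-1 + r + 2 * t) * x3 * x4 + (-1 + r) * x5
    + x2 * (-1 + r - (-1 + r + 2 * t) * x5) in
  (1 + zE + zN) * Q = P.
Proof.
move=> eE eN t r P Q; apply/eqP; rewrite -subr_eq0; apply/eqP.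
(* Q is twice the determinant of the system in [zE], [zN]; the multipliers are the column sums of
   its adjugate. *)
transitivity
  (2 * ((1 - c * x5 + c * x4) * (zE - c * (1 + x3 * zN + x2 * zE)) +
        (1 - c * x2 + c * x3) * (zN - c * (1 + x4 * zE + x5 * zN)))).
  by rewrite /P /Q /r /t; ring.
by rewrite -eE -eN !subrr !mulr0 addr0 mulr0.
Qed.

Definition match_weight (x y : step) : {mpoly rat[4]} :=
  match x, y with N, E => X2 | E, E => X3 | N, N => X4 | E, N => X5 end.

Lemma F2345_excursions :
  F2345 = 1 + excursion_fps match_weight E + excursion_fps match_weight N.
Proof.
apply/fpsP => -[|j]; rewrite 2!fps_coefD !fpsX_coefM; first by rewrite !addr0.
rewrite add0r addrC -balanced_wt_sumS.
transitivity (\sum_(L in lattice_paths j.+1) wt match_weight L); last first.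
  exact: sum_lattice_paths.
apply: eq_bigr => L; rewrite inE => /andP[/eqP cE _].
by rewrite -(@prod_mch _ match_weight j.+1) ?size_tuple.
Qed.

Theorem mainTheorem12 :
  let t := fpsX {mpoly rat[4]} in
  let x2 := fpsC X2 in let x3 := fpsC X3 in
  let x4 := fpsC X4 in let x5 := fpsC X5 in
  let r := fps_sqrt (1 - 4 * t) in
  let P := (-1 + r + 2 * t) * x3 * (-1 + x4) + x4 - r * x4 - 2 * t * x4
    + x2 * (- (-1 + r) * (-2 + x5) - 2 * t * (-1 + x5))
    + 2 * r * x5 + 2 * t * x5 - 2 * (-2 + r + x5) in
  let Q := 2 + (-1 + r + 2 * t) * x3 * x4 + (-1 + r) * x5
    + x2 * (-1 + r - (-1 + r + 2 * t) * x5) in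
  Q \is a GRing.unit /\ F2345 = P / Q.
Proof.
move=> t x2 x3 x4 x5 r P Q.
have unit2 : (2%:R : {mpoly rat[4]}) \is a GRing.unit.
  have -> : (2%:R : {mpoly rat[4]}) = (2%:R : rat)%:MP.
    by rewrite mpolyCMn mpolyC1.
  by apply/unitrP; exists ((2%:R : rat)^-1)%:MP; rewrite -!mpolyCM; split.
(* The constant coefficient of Q is 2, since that of [r] is 1. *)
have unitQ : Q \is a GRing.unit.
  have coef0M (f g : fps {mpoly rat[4]}) : (f * g)``_0 = f``_0 * g``_0.
    by rewrite fps_coefM big_ord1.
  rewrite fps_unitE /Q !(fps_coefD, fps_coefN, coef0M, fps_natr0).
  by rewrite fps_sqrt0 addNr !(mulr0, mul0r, addr0, subr0).
split=> //; apply: (mulIr unitQ); rewrite divrK //.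
have [C [rC eC]] := catalan_fps_sqrt unit2.
set c := t * C in rC.
(* This is the Catalan equation multiplied by [t]. *)
have tc : t = c - c ^+ 2.
  by rewrite /c -/t in eC *; rewrite {1}eC; ring.
have excE d : excursion_fps match_weight d =
    c * (1 + fpsC (match_weight d d) * excursion_fps match_weight (flip d)
           + fpsC (match_weight (flip d) d) * excursion_fps match_weight d).
  rewrite {1}/excursion_fps (path_sum_fps _ _ _ eC) departure_fps expr1.
  by rewrite mulrCA mulrC mulrAC.
have := two_state_system (excE E) (excE N).
by rewrite -rC -tc F2345_excursions.
Qed.
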